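(* Let $E, F$ be Riesz spaces and let $T \in \mathcal{O}(E,F)$ preserve disjointness. Then the following assertions hold. (1) $T \in \mathcal{P}(E,F)$. (2) $|T|$ exists in $\mathcal{O}(E,F)$ and $|T| \in \mathcal{P}(E,F)$. Moreover, for every $x \in E$ one has $|T|(x) = |T(x)|$. (3) $T$ is regular; $T^+$ and $T^-$ exist (in $\mathcal{O}(E,F)$) and both preserve disjointness. Moreover, for every $x \in E$ one has $T^+(x) = (T(x))^+$ and $T^-(x) = (T(x))^-$. (4) Let $\{x,y\} \subset E$ be a laterally bounded set. Then $(T(x))^+ \wedge (T(y))^- = 0$.
   Context: A Riesz space is a real vector lattice (no Dedekind completeness or Archimedean property is assumed); $x \perp y$ (disjointness) means $|x| \wedge |y| = 0$. An element $x$ is a fragment of $y$, written $x \sqsubseteq y$, if $x \perp y - x$; $\mathfrak{F}_e$ is the set of all fragments of $e$. A set $A \subseteq E$ is laterally bounded if there is $e \in E$ with $a \sqsubseteq e$ for all $a \in A$. A function $T \colon E \to F$ is an orthogonally additive operator (OAO) if $T(x+y) = T(x) + T(y)$ for all disjoint $x,y \in E$. $\mathcal{O}(E,F)$ is the vector space of all OAOs, ordered by $S \le T$ iff $S(x) \le T(x)$ for all $x \in E$; an OAO $T$ is positive if $T(x) \ge 0$ for all $x\in E$, and regular if it is a difference of two positive OAOs. $|T| := T \vee (-T)$, $T^+ := T \vee 0$, $T^- := (-T) \vee 0$, where the suprema are least upper bounds in the ordered vector space $\mathcal{O}(E,F)$. $T$ preserves disjointness if $T(x) \perp T(y)$ for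 all $x,y \in E$ with $x \perp y$. $\mathcal{P}(E,F)$ is the set of laterally-to-order bounded OAOs, i.e. those $T$ for which $T(\mathfrak{F}_e)$ is order bounded in $F$ for every $e \in E$. *)

(* Defs.v *)
From HB Require Import structures.
From mathcomp Require Import all_boot all_order all_algebra.
From mathcomp Require Import boolp classical_sets functions reals.

Set Implicit Arguments.
Unset Strict Implicit.
Unset Printing Implicit Defensive.

Import Order.TTheory GRing.Theory Num.Theory.
Local Open Scope classical_set_scope.
Local Open Scope ring_scope.

HB.mixin Record isOrderedLmodule (R : realType) V
    of Num.POrderedZmodule V & GRing.Lmodule R V := {
  lev_add2r : forall z x y : V, x <= y -> x + z <= y + z ;
  scalev_ge0 : forall (a : R) (x : V), 0 <= a -> 0 <= x -> 0 <= a *: x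
}.

#[short(type="orderedLmodType")]
HB.structure Definition OrderedLmodule (R : realType) :=
  {V of Num.POrderedZmodule V & GRing.Lmodule R V & isOrderedLmodule R V}.

(* A join with [Order.Lattice] is not possible here: Hierarchy Builder rejects it
   because [Num.RealDomain] already joins lattices and zmodules.  The lattice
   operations are therefore introduced with the axioms that [Order] uses for
   [Order.join] and [Order.meet]. *)
HB.mixin Record OrderedLmodule_isRiesz (R : realType) V
    of OrderedLmodule R V := {
  rjoin : V -> V -> V ;
  rmeet : V -> V -> V ;
  rleUx : forall x y z : V, (rjoin x y <= z) = (x <= z) && (y <= z) ;
  rlexI : forall x y z : V, (x <= rmeet y z) = (x <= y) && (x <= z)
}.

#[short(type="rieszType")]
HB.structure Definition Riesz (R : realType) :=
  {V of OrderedLmodule R V & OrderedLmodule_isRiesz R V}.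

Section RieszNotions.
Context {R : realType} {E : rieszType R}.
Implicit Types (x y e : E) (A : set E).

(* [`|x|] denotes the norm of a [normedZmodType]; the modulus of a Riesz space
   is not an instance of it, hence a separate name. *)
Definition rabs x : E := rjoin x (- x).
Definition rpos x : E := rjoin x 0.
Definition rneg x : E := rjoin (- x) 0.

Definition rdisjoint x y : Prop := rmeet (rabs x) (rabs y) = 0.

Definition fragment x y : Prop := rdisjoint x (y - x).
Definition fragments e : set E := [set x | fragment x e].

Definition laterally_bounded A : Prop :=
  exists e, forall a, A a -> fragment a e.

Definition order_bounded A : Prop :=
  exists a b, forall x, A x -> a <= x /\ x <= b.

End RieszNotions.

Section OAO.
Context {R : realType} (E F : rieszType R).

Definition orthogonally_additive (T : E -> F) : Prop :=
  forall x y, rdisjoint x y -> T (x + y) = T x + T y.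

Definition oao_pred : {pred (E -> F)} :=
  fun T => `[< orthogonally_additive T >].

Record oao := OAO { oao_fun :> E -> F ; _ : oao_fun \in oao_pred }.

HB.instance Definition _ := [isSub for oao_fun].
HB.instance Definition _ := [Choice of oao by <:].

Lemma oaoP (T : oao) : orthogonally_additive T.
Proof. by case: T => T /= /asboolP. Qed.

Lemma oao_submod_closed : submod_closed oao_pred.
Proof.
split=> [|a S T /asboolP hS /asboolP hT]; apply/asboolP => x y xy.
  by rewrite -[LHS]/(0 : F) -[RHS]/(0 + 0 : F) addr0.
rewrite -[LHS]/(a *: S (x + y) + T (x + y)).
rewrite -[RHS]/((a *: S x + T x) + (a *: S y + T y)).
by rewrite hS // hT // scalerDr addrACA.
Qed.

HB.instance Definition _ :=
  GRing.isSubmodClosed.Build R (E -> F) oao_pred oao_submod_closed.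
HB.instance Definition _ := [SubChoice_isSubLmodule of oao by <:].

HB.instance Definition _ := [SubChoice_isSubPOrder of oao by <: with ring_display].

Lemma oao_leP (S T : oao) : (S <= T) <-> (forall x, S x <= T x).
Proof. by split=> [/lefP|h]; last exact/lefP. Qed.

Fact oao_lev_add2r (U S T : oao) : S <= T -> S + U <= T + U.
Proof. by move=> /oao_leP h; apply/oao_leP => x; apply: lev_add2r. Qed.

Fact oao_scalev_ge0 (a : R) (T : oao) : 0 <= a -> 0 <= T -> 0 <= a *: T.
Proof.
by move=> a0 /oao_leP h; apply/oao_leP => x; apply: scalev_ge0 (h x).
Qed.

HB.instance Definition _ :=
  isOrderedLmodule.Build R oao oao_lev_add2r oao_scalev_ge0.

Definition oao_positive (T : oao) : Prop := forall x, 0 <= T x.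

Definition oao_regular (T : oao) : Prop :=
  exists S1 S2 : oao, [/\ oao_positive S1, oao_positive S2 & T = S1 - S2].

Definition preserves_disjointness (T : E -> F) : Prop :=
  forall x y, rdisjoint x y -> rdisjoint (T x) (T y).

Definition lat_order_bounded : set oao :=
  [set T : oao | forall e, order_bounded (T @` fragments e)].

(* [supremums A] is taken in the ordered vector space [oao], so the competing
   upper bounds are orthogonally additive operators only. *)
Definition is_oao_abs (T S : oao) : Prop := supremums [set T; - T] S.
Definition is_oao_pos (T S : oao) : Prop := supremums [set T; 0] S.
Definition is_oao_neg (T S : oao) : Prop := supremums [set - T; 0] S.

End OAO.

(* Main.v *)
(* Since [T] preserves disjointness, [x] being a fragment of [e] makes [T x] a
   fragment of [T e]; and positive and negative parts are additive on disjoint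
   pairs, because [u - v] has parts [u] and [v] as soon as [u] and [v] have
   meet [0].  So [x |-> |T x|], [x |-> (T x)^+] and [x |-> (T x)^-] are again
   orthogonally additive, hence are suprema in the space of operators because
   they are pointwise suprema; moreover [(T x)^+ <= (T e)^+] and
   [(T x)^- <= (T e)^-] whenever [x] is a fragment of [e]. *)
Require Import Defs.
From mathcomp Require Import all_boot all_order all_algebra.
From mathcomp Require Import boolp classical_sets functions reals.

Set Implicit Arguments.
Unset Strict Implicit.
Unset Printing Implicit Defensive.

Import Order.TTheory GRing.Theory Num.Theory.
Local Open Scope classical_set_scope.
Local Open Scope ring_scope.

(** * Arithmetic of order and lattice operations in a Riesz space *)

Section RieszTheory.
Context {R : realType} {V : rieszType R}.
Implicit Types a b u v w x y z : V.

Lemma lev_addr z x y : (x + z <= y + z) = (x <= y).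
Proof.
apply/idP/idP => [|h]; last exact: lev_add2r.
by move=> /(lev_add2r (- z) _ _); rewrite !addrK.
Qed.

Lemma lev_addl z x y : (z + x <= z + y) = (x <= y).
Proof. by rewrite ![z + _]addrC lev_addr. Qed.

Lemma lev_subl_addr x y z : (x - y <= z) = (x <= z + y).
Proof. by rewrite -[x - y <= z](lev_addr y) subrK. Qed.

Lemma lev_oppl x y : (- x <= y) = (- y <= x).
Proof.
by rewrite -[- x <= y](lev_addr x) addNr -[0 <= _](lev_addl (- y)) addr0 addKr.
Qed.

Lemma addv_ge0 x y : 0 <= x -> 0 <= y -> 0 <= x + y.
Proof.
by move=> x0 y0; apply: le_trans x0 _; rewrite -{1}[x]addr0 lev_addl.
Qed.

Lemma lev_pscale (c : R) x y : 0 < c -> (c *: x <= c *: y) = (x <= y).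
Proof.
have mono (d : R) u v : 0 <= d -> u <= v -> d *: u <= d *: v.
  move=> d0; rewrite -(lev_addr (- u)) subrr => /(scalev_ge0 _ _ d0).
  by rewrite scalerBr -(lev_addr (d *: u)) add0r subrK.
move=> c0; apply/idP/idP => [|]; last exact/mono/ltW.
have /mono h : 0 <= c^-1 by rewrite invr_ge0 ltW.
by move=> /h; rewrite !scalerA mulVf ?gt_eqF // !scale1r.
Qed.

(** An element is determined by the set of its upper bounds, so identities between joins reduce to
    rewriting inequalities; dually for meets. *)
Lemma rjoin_unique x y w :
  (forall z, (w <= z) = (x <= z) && (y <= z)) -> rjoin x y = w.
Proof. by move=> h; apply/le_anti; rewrite rleUx -h lexx h -rleUx lexx. Qed.

Lemma rmeet_unique x y w :
  (forall z, (z <= w) = (z <= x) && (z <= y)) -> rmeet x y = w.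
Proof. by move=> h; apply/le_anti; rewrite h -rlexI lexx rlexI -h lexx. Qed.

Lemma rjoinC x y : rjoin x y = rjoin y x.
Proof. by apply: rjoin_unique => z; rewrite rleUx andbC. Qed.

Lemma rmeetC x y : rmeet x y = rmeet y x.
Proof. by apply: rmeet_unique => z; rewrite rlexI andbC. Qed.

Lemma rjoinDr x y z : rjoin (x + z) (y + z) = rjoin x y + z.
Proof.
apply: rjoin_unique => t.
by rewrite -[t](subrK z) !lev_addr rleUx.
Qed.

Lemma rjoinZ (c : R) x y : 0 < c -> rjoin (c *: x) (c *: y) = c *: rjoin x y.
Proof.
move=> c0; apply: rjoin_unique => t.
have -> : t = c *: (c^-1 *: t) by rewrite scalerA mulfV ?gt_eqF // scale1r.
by rewrite !lev_pscale // rleUx.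
Qed.

Lemma rmeetN x y : rmeet (- x) (- y) = - rjoin x y.
Proof.
apply: rmeet_unique => t.
have levNr u : (t <= - u) = (u <= - t) by rewrite -{1}[t]opprK lev_oppl opprK.
by rewrite !levNr rleUx.
Qed.

Lemma rmeetDr x y z : rmeet (x + z) (y + z) = rmeet x y + z.
Proof.
apply: rmeet_unique => t.
by rewrite -[t](subrK z) !lev_addr rlexI.
Qed.

Lemma lev_joinl x y : x <= rjoin x y.
Proof. by have := lexx (rjoin x y); rewrite rleUx => /andP[]. Qed.

Lemma lev_joinr x y : y <= rjoin x y.
Proof. by rewrite rjoinC lev_joinl. Qed.

(** * Positive part, negative part and modulus *)

Lemma rpos_ge0 a : 0 <= rpos a.
Proof. exact: lev_joinr. Qed.

Lemma rneg_ge0 a : 0 <= rneg a.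
Proof. exact: lev_joinr. Qed.

Lemma rneg_rposN a : rneg a = rpos (- a).
Proof. by []. Qed.

Lemma rabsN a : rabs (- a) = rabs a.
Proof. by rewrite /rabs opprK rjoinC. Qed.

Lemma rposDN a : rneg a + a = rpos a.
Proof. by rewrite /rneg -rjoinDr addNr add0r rjoinC. Qed.

Lemma rposBneg a : rpos a - rneg a = a.
Proof. by rewrite -rposDN addrC addKr. Qed.

(** After adding [a], both sides equal twice [rpos a]: the left one is the join of [a + a] and [0],
    the right one follows from [rposDN]. *)
Lemma rabs_posDneg a : rabs a = rpos a + rneg a.
Proof.
apply: (addIr a); rewrite -addrA rposDN /rabs -rjoinDr addNr.
rewrite -mulr2n -[_ + _]mulr2n -!scaler_nat -rjoinZ ?ltr0n //.
by rewrite scaler0.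
Qed.

Lemma rabs_ge0 a : 0 <= rabs a.
Proof. by rewrite rabs_posDneg addv_ge0 ?rpos_ge0 ?rneg_ge0. Qed.

Lemma rabs_id a : 0 <= a -> rabs a = a.
Proof.
move=> a0; apply: rjoin_unique => z; case: (boolP (a <= z)) => //= az.
by apply/esym/(le_trans _ (le_trans a0 az)); rewrite lev_oppl oppr0.
Qed.

Lemma rpos_le_abs a : rpos a <= rabs a.
Proof. by rewrite rabs_posDneg -{1}[rpos a]addr0 lev_addl rneg_ge0. Qed.

Lemma rneg_le_abs a : rneg a <= rabs a.
Proof. by rewrite -rabsN rneg_rposN rpos_le_abs. Qed.

(** Translating [a] and [0] by [rneg a] gives the two parts, and the meet of [a] and [0] is
    [- rneg a]. *)
Lemma rmeet_pos_neg a : rmeet (rpos a) (rneg a) = 0.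
Proof.
rewrite -rposDN addrC -{2}[rneg a]add0r rmeetDr -{1}[a]opprK -oppr0 rmeetN.
by rewrite oppr0 addNr.
Qed.

(** * Disjointness and additivity of the parts *)

Lemma rmeet_eq0_le u v x y :
  0 <= x -> 0 <= y -> x <= u -> y <= v -> rmeet u v = 0 -> rmeet x y = 0.
Proof.
move=> x0 y0 xu yv uv; apply: rmeet_unique => z.
apply/idP/andP => [z0|[zx zy]]; first by split; apply: le_trans z0 _.
by rewrite -uv rlexI (le_trans zx xu) (le_trans zy yv).
Qed.

(** If [z] is below [u] and [v + w], then [z - w] is below [u] and [v], hence below [0]; so [z] is
    below both [u] and [w]. *)
Lemma rmeet_addr_eq0 u v w : 0 <= u -> 0 <= v -> 0 <= w ->
  rmeet u v = 0 -> rmeet u w = 0 -> rmeet u (v + w) = 0.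
Proof.
move=> u0 v0 w0 uv uw; apply: rmeet_unique => z.
apply/idP/andP => [z0|[zu zvw]].
  by split; apply: le_trans z0 _; rewrite ?addv_ge0.
rewrite -uw rlexI zu /= -[w]add0r -lev_subl_addr -uv rlexI !lev_subl_addr zvw.
by rewrite andbT (le_trans zu)// -{1}[u]addr0 lev_addl.
Qed.

(** Translation by [- u] turns the join of [u - v] and [0] into that of [- v] and [- u], which is
    minus the meet. *)
Lemma rpos_unique u v : rmeet u v = 0 -> rpos (u - v) = u.
Proof.
move=> uv; apply: (addIr (- u)); rewrite subrr /rpos -rjoinDr add0r.
by rewrite addrAC subrr add0r rjoinC -[LHS]opprK -rmeetN !opprK uv oppr0.
Qed.

Lemma rdisjoint_le a b x y : rabs x <= rabs a -> rabs y <= rabs b ->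
  rdisjoint a b -> rdisjoint x y.
Proof. by move=> xa yb; apply: rmeet_eq0_le; rewrite ?rabs_ge0. Qed.

Lemma rposD a b : rdisjoint a b -> rpos (a + b) = rpos a + rpos b.
Proof.
move=> ab.
have pn : rmeet (rpos a) (rneg b) = 0.
  exact: rmeet_eq0_le (rpos_ge0 _) (rneg_ge0 _) (rpos_le_abs _)
    (rneg_le_abs _) ab.
have np : rmeet (rneg a) (rpos b) = 0.
  exact: rmeet_eq0_le (rneg_ge0 _) (rpos_ge0 _) (rneg_le_abs _)
    (rpos_le_abs _) ab.
(* The two sums have meet [0], since all four pairs of summands do: [pn] and [np] cover the mixed
   pairs, [rmeet_pos_neg] the others. *)
have -> : a + b = rpos a + rpos b - (rneg a + rneg b).
  by rewrite opprD addrACA !rposBneg.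
apply: rpos_unique.
rewrite rmeet_addr_eq0 ?addv_ge0 ?rpos_ge0 ?rneg_ge0 // rmeetC.
  by rewrite rmeet_addr_eq0 ?rpos_ge0 ?rneg_ge0 // rmeetC rmeet_pos_neg.
rewrite rmeet_addr_eq0 ?rpos_ge0 ?rneg_ge0 // rmeetC //.
exact: rmeet_pos_neg.
Qed.

Lemma rdisjointN a b : rdisjoint a b -> rdisjoint (- a) (- b).
Proof. by rewrite /rdisjoint !rabsN. Qed.

Lemma rnegD a b : rdisjoint a b -> rneg (a + b) = rneg a + rneg b.
Proof. by move=> /rdisjointN /rposD; rewrite !rneg_rposN opprD. Qed.

Lemma rabsD a b : rdisjoint a b -> rabs (a + b) = rabs a + rabs b.
Proof. by move=> ab; rewrite !rabs_posDneg rposD ?rnegD // addrACA. Qed.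

(** Additivity on [b = a + (b - a)] leaves the nonnegative surplus [rpos (b - a)]. *)
Lemma fragment_rpos_le a b : fragment a b -> rpos a <= rpos b.
Proof.
move=> /rposD; rewrite addrC subrK => ->.
by rewrite -{1}[rpos a]addr0 lev_addl rpos_ge0.
Qed.

Lemma fragmentN a b : fragment a b -> fragment (- a) (- b).
Proof. by rewrite /fragment -opprD => /rdisjointN. Qed.

Lemma fragment_rneg_le a b : fragment a b -> rneg a <= rneg b.
Proof. by move=> /fragmentN /fragment_rpos_le. Qed.

End RieszTheory.

(** * Disjointness preserving operators *)

Section DisjointnessPreserving.
Context {R : realType} {E F : rieszType R}.
Implicit Types T : oao E F.

(** Orthogonal additivity gives [T e - T x = T (e - x)], which is disjoint from [T x]. *)
Lemma preserves_fragment T (hT : preserves_disjointness T) x e :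
  fragment x e -> fragment (T x) (T e).
Proof.
move=> xe; rewrite /fragment.
by rewrite -{1}[e](subrK x) [e - x + x]addrC oaoP // addrC addKr; apply: hT.
Qed.

Lemma preserves_lat_order_bounded T :
  preserves_disjointness T -> lat_order_bounded T.
Proof.
move=> hT e; exists (- rneg (T e)), (rpos (T e)) => _ [x xe <-].
have {}xe := preserves_fragment hT xe.
split; last exact: le_trans (lev_joinl _ _) (fragment_rpos_le xe).
by rewrite lev_oppl; apply: le_trans (lev_joinl _ _) (fragment_rneg_le xe).
Qed.

Lemma preservesN T : preserves_disjointness T -> preserves_disjointness (- T).
Proof. by move=> hT x y /hT /rdisjointN. Qed.

Fact abs_oao_subproof T :
  preserves_disjointness T -> (fun x => rabs (T x)) \in @oao_pred R E F.
Proof.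
by move=> hT; apply/asboolP => x y xy; rewrite oaoP // rabsD //; exact: hT.
Qed.

Fact pos_oao_subproof T :
  preserves_disjointness T -> (fun x => rpos (T x)) \in @oao_pred R E F.
Proof.
by move=> hT; apply/asboolP => x y xy; rewrite oaoP // rposD //; exact: hT.
Qed.

Definition abs_oao T (hT : preserves_disjointness T) : oao E F :=
  OAO (abs_oao_subproof hT).

(** This also serves for the negative part, as [pos_oao] of [- T], because [rneg a] is [rpos (- a)]
    by definition. *)
Definition pos_oao T (hT : preserves_disjointness T) : oao E F :=
  OAO (pos_oao_subproof hT).

Lemma pointwise_join_supremums (S T U : oao E F) :
  (forall x, U x = rjoin (S x) (T x)) -> supremums [set S; T] U.
Proof.
move=> hU; split=> [W [->|->]|W hW]; apply/oao_leP => x; rewrite hU.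
- exact: lev_joinl.
- exact: lev_joinr.
have /oao_leP SW : S <= W by apply: hW; left.
have /oao_leP TW : T <= W by apply: hW; right.
by rewrite rleUx SW TW.
Qed.

Lemma abs_oao_preserves T (hT : preserves_disjointness T) :
  preserves_disjointness (abs_oao hT).
Proof.
by move=> x y /hT; apply: rdisjoint_le; rewrite rabs_id ?rabs_ge0.
Qed.

Lemma pos_oao_preserves T (hT : preserves_disjointness T) :
  preserves_disjointness (pos_oao hT).
Proof.
move=> x y /hT; apply: rdisjoint_le;
  by rewrite rabs_id ?rpos_ge0 ?rpos_le_abs.
Qed.

Lemma pos_oaoB T (hT : preserves_disjointness T) :
  T = pos_oao hT - pos_oao (preservesN hT).
Proof. by apply/val_inj/funext => x; apply/esym/(rposBneg (T x)). Qed.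

End DisjointnessPreserving.

Theorem theorem4p2 (R : realType) (E F : rieszType R) (T : oao E F)
    (hT : preserves_disjointness T) :
  [/\ lat_order_bounded T,
      exists absT : oao E F,
        [/\ is_oao_abs T absT, lat_order_bounded absT
          & forall x : E, absT x = rabs (T x)],
      oao_regular T /\
      exists Tpos Tneg : oao E F,
        [/\ is_oao_pos T Tpos /\ is_oao_neg T Tneg,
            preserves_disjointness Tpos /\ preserves_disjointness Tneg,
            forall x : E, Tpos x = rpos (T x)
          & forall x : E, Tneg x = rneg (T x)]
    & forall x y : E, laterally_bounded [set x; y] ->
        rmeet (rpos (T x)) (rneg (T y)) = 0].
Proof.
split.
- exact: preserves_lat_order_bounded.
- exists (abs_oao hT); split=> //; first exact: pointwise_join_supremums.
  (* The modulus operator preserves disjointness too, so the first assertion applies to it. *)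
  exact/preserves_lat_order_bounded/abs_oao_preserves.
- split.
    exists (pos_oao hT), (pos_oao (preservesN hT)).
    by split; [move=> x; exact: rpos_ge0..|exact: pos_oaoB].
  exists (pos_oao hT), (pos_oao (preservesN hT)); split=> //.
    by split; apply: pointwise_join_supremums.
  by split; apply: pos_oao_preserves.
- move=> x y [e he].
  have /(preserves_fragment hT) xe : fragment x e by apply: he; left.
  have /(preserves_fragment hT) ye : fragment y e by apply: he; right.
  (* The two parts are dominated by [rpos (T e)] and [rneg (T e)], whose meet is [0]. *)
  exact: rmeet_eq0_le (rpos_ge0 _) (rneg_ge0 _) (fragment_rpos_le xe)
    (fragment_rneg_le ye) (rmeet_pos_neg _).
Qed.
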